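(* Let $X=(X,\omega_X,\mu_X)$ be a finite measure network. There exists $\epsilon_{[X]}>0$ such that for any tangent vector $[f]\in T_{[X]}$ represented by a function $f\in L^2(Z^2,\mu_Z^{\otimes 2})$ with $Z=(Z,\omega_Z,\mu_Z)\in[X]$ satisfying $|f(z,z')|<\epsilon_{[X]}$ for all $(z,z')\in Z\times Z$, the point $\exp_{[X]}([f])$ is the endpoint of a geodesic emanating from $[X]$.
   Context: A measure network is a triple $(X,\omega_X,\mu_X)$ where $X$ is a Polish space, $\mu_X$ is a fully supported Borel probability measure on $X$, and $\omega_X:X\times X\to\mathbb{R}$ is square integrable with respect to $\mu_X^{\otimes 2}$. It is finite if $X$ is a finite set. It is often denoted simply by $X$. For measure networks $X,Y$, let $\mathscr{C}(\mu_X,\mu_Y)$ be the set of couplings, i.e. probability measures on $X\times Y$ with marginals $\mu_X,\mu_Y$. The distortion of $\mu\in\mathscr{C}(\mu_X,\mu_Y)$ is $$\operatorname{dis}(\mu)=\Big(\int\int|\omega_X(x,x')-\omega_Y(y,y')|^2\,d\mu(x',y')\,d\mu(x,y)\Big)^{1/2},$$ and the Gromov-Wasserstein distance is $d_{\mathcal N}(X,Y)=\frac12\inf_{\mu\in\mathscr{C}(\mu_X,\mu_Y)}\operatorname{dis}(\mu)$. Measure networks $X,Y$ are weakly isomorphic if there exist a Borel probability space $(W,\mu_W)$ and maps $\pi_X:W\to X$, $\pi_Y:W\to Y$ with $(\pi_X)_\#\mu_W=\mu_X$, $(\pi_Y)_\#\mu_W=\mu_Y$ and $\|(\pi_X)^*\omega_X-(\pi_Y)^*\omega_Y\|_\infty=0$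 (essential supremum for $\mu_W^{\otimes2}$), where $(\pi_X)^*\omega_X(w,w')=\omega_X(\pi_X(w),\pi_X(w'))$ and similarly for $Y$. This is equivalent to $d_{\mathcal N}(X,Y)=0$. The weak isomorphism class of $X$ is written $[X]=[X,\omega_X,\mu_X]$, and $[\mathcal N]$ is the set of all classes, with the metric induced by $d_{\mathcal N}$. The tangent space at $[X]$ is $T_{[X]}=\bigcup_{Z\in[X]}L^2(Z^2,\mu_Z^{\otimes2})/\sim$, where for $Y,Z\in[X]$, $f\in L^2(Y^2,\mu_Y^{\otimes2})$ and $g\in L^2(Z^2,\mu_Z^{\otimes2})$, one has $f\sim g$ iff there is a coupling $\mu$ of $\mu_Y$ and $\mu_Z$ with $\omega_Y(y,y')=\omega_Z(z,z')$ and $f(y,y')=g(z,z')$ for $\mu^{\otimes2}$-a.e. $((y,z),(y',z'))\in(Y\times Z)^2$. The class of $f$ is denoted $[f]$. The exponential map $\exp_{[X]}:T_{[X]}\to[\mathcal N]$ is $\exp_{[X]}([f])=[Z,\omega_Z+f,\mu_Z]$ for $f\in L^2(Z^2,\mu_Z^{\otimes2})$, $Z\in[X]$. A geodesic from $[X]$ to $[Y]$ in $[\mathcal N]$ is a continuous map $\gamma:[S,T]\to[\mathcal N]$ with $\gamma(S)=[X]$, $\gamma(T)=[Y]$ and $d_{\mathcal N}(\gamma(s),\gamma(t))=\frac{|t-s|}{T-S}\,d_{\mathcal N}([X],[Y])$ for all $s,t\in[S,T]$. A geodesic $\gamma:[0,T]\to[\mathcal N]$ emanates from $[X]$ if $\gamma(0)=[X]$;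 its endpoint is $\gamma(T)$. *)

(* Defs.v *)
From mathcomp Require Import all_boot all_order all_algebra.
From mathcomp Require Import all_classical all_reals all_analysis.
Import Order.TTheory GRing.Theory Num.Theory.
Import numFieldNormedType.Exports.

Set Implicit Arguments.
Unset Strict Implicit.
Unset Printing Implicit Defensive.

Local Open Scope classical_set_scope.
Local Open Scope ring_scope.

Section polish_spaces.
Variable R : realType.

Definition polish (X : topologicalType) : Prop :=
  (exists2 D : set X, countable D & dense D) /\
  exists d : X -> X -> R,
    [/\ (forall x y, d x y = 0 <-> x = y),
        (forall x y, d x y = d y x),
        (forall x y z, d x z <= d x y + d y z),
        (forall A : set X, open A <->
           forall x, A x -> exists2 e, 0 < e & [set y | d x y < e] `<=` A) &
        (forall u : nat -> X,
           (forall e, 0 < e -> exists N, forall m n,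
              (N <= m)%N -> (N <= n)%N -> d (u m) (u n) < e) ->
           exists l, forall e, 0 < e -> exists N, forall n,
              (N <= n)%N -> d (u n) l < e)].

End polish_spaces.

(* The points of [X] with the Borel sigma-algebra.  On a product of two such
   types the library puts the product sigma-algebra, which is the Borel one
   when the factors are Polish. *)
Notation borel X := (g_sigma_algebraType (@open X)).

Lemma le12 (R : realType) : (1 <= 2%:E :> \bar R)%E.
Proof. by rewrite lee_fin ler1n. Qed.

(* Square-integrable functions, not identified up to a.e. equality. *)
Notation L2fun mu := (LfunType mu (le12 _)).

Record network (R : realType) := Network {
  pts : ptopologicalType;
  pts_polish : polish R pts;
  nmu : probability (borel pts) R;
  nmu_full : forall U : set pts, open U -> U !=set0 -> (0 < nmu U)%E;
  nomega : L2fun (nmu \x nmu)%E }.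

Section measure_networks.
Variable R : realType.
Implicit Types X Y Z : network R.

Local Notation bpts X := (borel (pts X)).

Definition finite_network X : Prop := finite_set [set: pts X].

(* A probability is a set function defined on all sets but only meaningful on
   measurable ones, whence the restriction on A. *)
Definition has_image d1 d2 (T1 : measurableType d1) (T2 : measurableType d2)
    (m : probability T1 R) (f : T1 -> T2) (m' : probability T2 R) : Prop :=
  forall A, measurable A -> pushforward m f A = m' A.

Definition couplings X Y : set (probability (bpts X * bpts Y)%type R) :=
  [set m | has_image m fst (nmu X) /\ has_image m snd (nmu Y)].

Arguments couplings : clear implicits.

Definition dis X Y (m : probability (bpts X * bpts Y)%type R) : \bar R :=
  ((\int[m]_p \int[m]_q
      (`|nomega X (p.1, q.1) - nomega Y (p.2, q.2)| ^+ 2)%:E) `^ 2^-1)%E.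

Definition gw_dist X Y : \bar R :=
  ((2^-1)%:E * ereal_inf [set dis m | m in couplings X Y])%E.

Definition weak_iso X Y : Prop :=
  exists (W : ptopologicalType) (muW : probability (borel W) R)
         (pX : borel W -> bpts X) (pY : borel W -> bpts Y),
    [/\ measurable_fun setT pX /\ measurable_fun setT pY,
        has_image muW pX (nmu X),
        has_image muW pY (nmu Y) &
        ('N[(muW \x muW)%E]_+oo
           [(fun w => (nomega X (pX w.1, pX w.2)
                       - nomega Y (pY w.1, pY w.2))%:E)] = 0)%E].

(* Weak isomorphism classes.  They are plain predicates because the universe of
   the library's [set] is too small to contain the type of all networks. *)
Definition nclass : Type :=
  {C : network R -> Prop | exists X, C = weak_iso X}.

Definition class_of X : nclass :=
  exist _ (weak_iso X) (ex_intro _ X erefl).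

Definition in_class X (C : nclass) : Prop := sval C X.

(* gw_dist is invariant under weak isomorphism, so the infimum is taken over a
   single value: this is the metric induced by gw_dist on classes. *)
Definition class_dist (C D : nclass) : \bar R :=
  ereal_inf [set r | exists X Y,
    [/\ in_class X C, in_class Y D & r = gw_dist X Y]].

Record tangent_rep (C : nclass) := TangentRep {
  tr_base : network R;
  tr_in : in_class tr_base C;
  tr_fun : L2fun (nmu tr_base \x nmu tr_base)%E }.

Definition tangent_equiv (C : nclass) (a b : tangent_rep C) : Prop :=
  exists2 m, couplings (tr_base a) (tr_base b) m &
    \forall p \ae (m \x m)%E,
      nomega (tr_base a) (p.1.1, p.2.1) = nomega (tr_base b) (p.1.2, p.2.2) /\
      tr_fun a (p.1.1, p.2.1) = tr_fun b (p.1.2, p.2.2).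

Definition tangent_space (C : nclass) : Type :=
  {v : tangent_rep C -> Prop | exists a, v = tangent_equiv a}.

Definition tangent_class (C : nclass) (a : tangent_rep C) : tangent_space C :=
  exist _ (tangent_equiv a) (ex_intro _ a erefl).

Definition shift Z (f : L2fun (nmu Z \x nmu Z)%E) : network R :=
  Network (pts_polish Z) (@nmu_full R Z) (nomega Z + f).

Definition tangent_repr (C : nclass) (v : tangent_space C) : tangent_rep C :=
  sval (cid (svalP v)).

(* Computed on a chosen representative; another one gives a weakly isomorphic
   network. *)
Definition texp (C : nclass) (v : tangent_space C) : nclass :=
  class_of (shift (tr_fun (tangent_repr v))).

Definition is_geodesic (S T : R) (gamma : R -> nclass) (C D : nclass) : Prop :=
  [/\ S < T,
      (forall s, s \in `[S, T] -> forall e, 0 < e ->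
         exists2 delta, 0 < delta & forall t, t \in `[S, T] ->
           `|t - s| < delta -> (class_dist (gamma s) (gamma t) < e%:E)%E),
      gamma S = C,
      gamma T = D &
      forall s t, s \in `[S, T] -> t \in `[S, T] ->
        class_dist (gamma s) (gamma t)
        = ((`|t - s| / (T - S))%:E * class_dist C D)%E].

End measure_networks.

(* Main.v *)
From HB Require Import structures.
Require Import Defs.
From mathcomp Require Import all_boot all_order all_algebra.
From mathcomp Require Import all_classical all_reals all_analysis.
From mathcomp Require Import measurable_realfun lra.
Import Order.TTheory GRing.Theory Num.Theory.
Import numFieldNormedType.Exports.
Local Open Scope classical_set_scope.
Local Open Scope ring_scope.

Set Implicit Arguments.
Unset Strict Implicit.
Unset Printing Implicit Defensive.

(** Let S be the finite set of values of omega_X and h(r) the distance from r to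
S.  As h is 1-Lipschitz, Minkowski's inequality shows that the L2 norm of
h o omega_Y changes by at most dis(m) along any coupling m, and it is clearly
invariant under weak isomorphism.  If |f| is at most half the smallest gap of S
then h(omega_Z + s f) = s |f| almost everywhere for s in [0, 1], so this norm is
s ||f|| at (Z, omega_Z + s f); hence the distance between the classes of
parameters s and t is at least |t - s| ||f|| / 2.  The diagonal coupling shows
that it is at most this, so s |-> [Z, omega_Z + s f] is a geodesic.  No gluing of
couplings is needed. *)

(** * Distance from a real number to a finite set of reals *)

Section dist_seq.
Variable R : realType.
Implicit Types (a r x : R) (l : seq R).

(** The head [a] is separate so that the minimum runs over the nonempty list [a :: l]. *)
Fixpoint dist_seq a l r : R :=
  if l is b :: l' then Num.min `|r - b| (dist_seq a l' r) else `|r - a|.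

Lemma dist_seq_ge0 a l r : 0 <= dist_seq a l r.
Proof. by elim: l => //= b l IH; rewrite le_min normr_ge0. Qed.

Lemma dist_seq_le a l r b : b \in a :: l -> dist_seq a l r <= `|r - b|.
Proof.
rewrite in_cons => /predU1P[->|].
  by elim: l => //= c l IH; rewrite ge_min IH orbT.
elim: l => //= c l IH; rewrite in_cons ge_min => /predU1P[->|/IH ->].
  by rewrite lexx.
by rewrite orbT.
Qed.

Lemma dist_seq_attained a l r :
  exists2 b, b \in a :: l & dist_seq a l r = `|r - b|.
Proof.
elim: l => [|c l [b bl IH]] /=; first by exists a; rewrite ?mem_head.
have [_|_] := leP `|r - c| (dist_seq a l r).
  by exists c; rewrite // !in_cons eqxx orbT.
by exists b => //; move: bl; rewrite !in_cons => /orP[->|->]; rewrite ?orbT.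
Qed.

Lemma dist_seq_eq0 a l r : dist_seq a l r = 0 <-> r \in a :: l.
Proof.
split => [|ral].
  have [b bal ->] := dist_seq_attained a l r => /eqP.
  by rewrite normr_eq0 subr_eq0 => /eqP ->.
by apply/le_anti; rewrite dist_seq_ge0 (le_trans (dist_seq_le _ ral))// subrr normr0.
Qed.

Lemma dist_seq_lip a l r r' : dist_seq a l r <= `|r - r'| + dist_seq a l r'.
Proof.
have [b bal ->] := dist_seq_attained a l r'.
by rewrite (le_trans (dist_seq_le _ bal))// ler_distD.
Qed.

Lemma measurable_dist_seq a l : measurable_fun setT (dist_seq a l).
Proof.
have mn b : measurable_fun setT (fun r : R => `|r - b|).
  by apply: measurableT_comp => //; exact: measurable_funB.
by elim: l => [|b l IH] //=; exact: measurable_minr.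
Qed.

Lemma seq_gap l : exists2 e, 0 < e &
  {in l &, forall b c, b != c -> e + e <= `|b - c|}.
Proof.
(* The starting value [1] covers lists without two distinct entries; the witness is [m / 2]. *)
pose m := \big[Num.min/1]_(p <- [seq (b, c) | b <- l, c <- l] | p.1 != p.2)
   `|p.1 - p.2|.
have m0 : 0 < m.
  rewrite /m; apply: (big_ind (fun x => 0 < x)) => // [x y x0 y0|[b c]/= bc].
    by rewrite lt_min x0.
  by rewrite normr_gt0 subr_eq0.
exists (m / 2) => [|b c bl cl bc]; first by rewrite divr_gt0.
rewrite -splitr.
have : (b, c) \in [seq (b, c) | b <- l, c <- l] by apply/allpairsP; exists (b, c).
rewrite {m0}/m; elim: [seq _ | b <- l, c <- l] => //= p s IH.
rewrite in_cons big_cons => /predU1P[<-|bcs].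
  by rewrite /= bc ge_min lexx.
by case: ifP => _; rewrite ?ge_min IH// orbT.
Qed.

(** Any other entry is at least [e + e] away from [b], hence at least [e] away from [b + x], so [b]
    remains a nearest entry. *)
Lemma dist_seq_near a l e b x : b \in a :: l ->
    {in a :: l &, forall b c, b != c -> e + e <= `|b - c|} ->
  `|x| <= e -> dist_seq a l (b + x) = `|x|.
Proof.
move=> bal gap xe; apply/le_anti/andP; split.
  by rewrite (le_trans (dist_seq_le _ bal))// addrC addKr.
have [c cal ->] := dist_seq_attained a l (b + x).
have [->|bc] := eqVneq b c; first by rewrite [c + x]addrC addrK.
have := gap _ _ bal cal bc.
have := ler_normD (b + x - c) (- x); rewrite normrN.
have -> : b + x - c - x = b - c by rewrite addrAC addrK.
by lra.
Qed.

End dist_seq.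

(** * L2 norms on product spaces: change of variables and comparison *)

Lemma measurable_sqr_norm d (T : measurableType d) (R : realType) (u : T -> R) :
  measurable_fun setT u -> measurable_fun setT (fun x => (`|u x| `^ 2)%:E).
Proof.
move=> m_u; apply/measurable_EFinP.
apply: (@measurableT_comp _ _ _ _ _ _ (@powR R ^~ 2)) => //.
exact: measurableT_comp.
Qed.

Section Lnorm_image.
Local Open Scope ereal_scope.
Context d d' {T : measurableType d} {U : measurableType d'} {R : realType}.
Variables (m : probability T R) (mu : probability U R) (f : T -> U).
Hypotheses (mf : measurable_fun setT f) (mfmu : has_image m f mu).

Let ge0_integral_image (g : U -> \bar R) :
  measurable_fun setT g -> (forall x, 0 <= g x) ->
  \int[m]_x g (f x) = \int[mu]_x g x.
Proof.
move=> mg g0.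
transitivity (\int[pushforward m f]_x g x).
  by rewrite (ge0_integral_pushforward mf)// preimage_setT.
by apply: eq_measure_integral => A mA _; exact: mfmu.
Qed.

Lemma measurable_pair_image : measurable_fun setT (fun p : T * T => (f p.1, f p.2)).
Proof. by apply: measurable_fun_pair; exact: measurableT_comp. Qed.

Lemma measurable_comp_pair (u : U * U -> R) : measurable_fun setT u ->
  measurable_fun setT (fun p : T * T => u (f p.1, f p.2)).
Proof. by move=> m_u; exact: (measurableT_comp m_u measurable_pair_image). Qed.

(** By Tonelli, the change of variables can be made in one coordinate at a time. *)
Lemma ge0_integral2_image (g : U * U -> \bar R) :
  measurable_fun setT g -> (forall x, 0 <= g x) ->
  \int[m \x m]_p g (f p.1, f p.2) = \int[mu \x mu]_p g p.
Proof.
move=> mg g0.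
rewrite !fubini_tonelli1//; last first.
  exact: (measurableT_comp mg measurable_pair_image).
rewrite /fubini_F /=.
transitivity (\int[m]_x \int[mu]_y g (f x, y)).
  apply: eq_integral => x _.
  by rewrite (@ge0_integral_image (fun y => g (f x, y)))//; exact: measurableT_comp.
rewrite (@ge0_integral_image (fun x => \int[mu]_y g (x, y)))//.
  exact: measurable_fun_fubini_tonelli_F.
by move=> x; exact: integral_ge0.
Qed.

Lemma Lnorm_image (u : U * U -> R) : measurable_fun setT u ->
  'N[m \x m]_2%:E[EFin \o (fun p => u (f p.1, f p.2))] =
  'N[mu \x mu]_2%:E[EFin \o u].
Proof.
move=> mu_; rewrite unlock /=.
rewrite (ge0_integral2_image (g := fun p => (`|u p| `^ 2)%R%:E))//.
exact: measurable_sqr_norm.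
Qed.

End Lnorm_image.

Section Lnorm_comparison.
Local Open Scope ereal_scope.
Context d {T : measurableType d} {R : realType}.
Variable mu : {measure set T -> \bar R}.
Implicit Types u v w : T -> R.

Lemma ae_eq_Lnorm2 u v : measurable_fun setT u -> measurable_fun setT v ->
    (\forall x \ae mu, `|u x|%R = `|v x|%R) ->
  'N[mu]_2%:E[EFin \o u] = 'N[mu]_2%:E[EFin \o v].
Proof.
move=> m_u m_v uv; rewrite unlock /=.
apply: (congr1 (@poweR R ^~ 2^-1%R)).
apply: ge0_ae_eq_integral => //; [exact: measurable_sqr_norm ..|].
by apply: filterS uv => x uvx _ /=; rewrite uvx.
Qed.

Lemma Lnorm2_triangle u v w :
    measurable_fun setT u -> measurable_fun setT v -> measurable_fun setT w ->
    (forall x, `|u x| <= `|v x| + `|w x|)%R ->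
  'N[mu]_2%:E[EFin \o u] <= 'N[mu]_2%:E[EFin \o v] + 'N[mu]_2%:E[EFin \o w].
Proof.
move=> m_u m_v m_w uvw.
(* Minkowski is applied to the absolute values, whose sum dominates [u] pointwise. *)
pose a x := `|v x|%R; pose b x := `|w x|%R.
have m_a : measurable_fun setT a by exact: measurableT_comp.
have m_b : measurable_fun setT b by exact: measurableT_comp.
rewrite -(@ae_eq_Lnorm2 a v)//; last by apply: nearW => x; rewrite normr_id.
rewrite -(@ae_eq_Lnorm2 b w)//; last by apply: nearW => x; rewrite normr_id.
apply: le_trans (minkowski_EFin _ _ _ _); rewrite ?ler1n//.
rewrite unlock /=; apply: (@gt0_ler_poweR R 2^-1%R); first by rewrite invr_ge0.
- by rewrite in_itv/= leey andbT; apply: integral_ge0 => x _; rewrite lee_fin powR_ge0.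
- by rewrite in_itv/= leey andbT; apply: integral_ge0 => x _; rewrite lee_fin powR_ge0.
apply: ge0_le_integral => //.
- exact: measurable_sqr_norm.
- by apply: (@measurable_sqr_norm _ _ _ (a \+ b)%R); exact: measurable_funD.
move=> x _; rewrite lee_fin ge0_ler_powR ?nnegrE//=.
by rewrite (le_trans (uvw x))// ler_norm.
Qed.

End Lnorm_comparison.

Section two_images.
Local Open Scope ereal_scope.
Context d d1 d2 {T : measurableType d} {U : measurableType d1}
  {V : measurableType d2} {R : realType}.
Variables (m : probability T R) (mu : probability U R) (nu : probability V R).
Variables (f : T -> U) (g : T -> V) (u : U * U -> R) (v : V * V -> R) (k : R -> R).
Hypotheses (mf : measurable_fun setT f) (mg : measurable_fun setT g).
Hypotheses (mfmu : has_image m f mu) (mgnu : has_image m g nu).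
Hypotheses (m_u : measurable_fun setT u) (m_v : measurable_fun setT v).
Hypothesis m_k : measurable_fun setT k.

Lemma measurable_image_sub :
  measurable_fun setT (fun p : T * T => u (f p.1, f p.2) - v (g p.1, g p.2))%R.
Proof.
by apply: measurable_funB;
  [exact: (measurable_comp_pair mf)|exact: (measurable_comp_pair mg)].
Qed.

(** Both norms pull back to [m \x m]. This serves weak isomorphisms, with a distance as [k], and
    tangent equivalence, with a truncation as [k]. *)
Lemma Lnorm2_ae_eq_image :
    (\forall p \ae m \x m, u (f p.1, f p.2) = v (g p.1, g p.2)) ->
  'N[mu \x mu]_2%:E[EFin \o (fun p => k (u p))] =
  'N[nu \x nu]_2%:E[EFin \o (fun p => k (v p))].
Proof.
have mku : measurable_fun setT (fun p => k (u p)) by exact: measurableT_comp.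
have mkv : measurable_fun setT (fun p => k (v p)) by exact: measurableT_comp.
move=> uv; rewrite -(Lnorm_image mf mfmu)// -(Lnorm_image mg mgnu)//.
apply: ae_eq_Lnorm2; [exact: (measurable_comp_pair mf mku) |
  exact: (measurable_comp_pair mg mkv) | by apply: filterS uv => p ->].
Qed.

(** After pulling back to [m \x m], the Lipschitz bound on [k] holds pointwise and Minkowski
    applies. The additive form makes sense for infinite norms too. *)
Lemma Lnorm2_lip_image :
    (forall r s, 0 <= k r /\ k r <= `|r - s| + k s)%R ->
  'N[mu \x mu]_2%:E[EFin \o (fun p => k (u p))] <=
     'N[m \x m]_2%:E[EFin \o (fun p => u (f p.1, f p.2) - v (g p.1, g p.2))%R] +
     'N[nu \x nu]_2%:E[EFin \o (fun p => k (v p))] /\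
  'N[nu \x nu]_2%:E[EFin \o (fun p => k (v p))] <=
     'N[m \x m]_2%:E[EFin \o (fun p => u (f p.1, f p.2) - v (g p.1, g p.2))%R] +
     'N[mu \x mu]_2%:E[EFin \o (fun p => k (u p))].
Proof.
have mku : measurable_fun setT (fun p => k (u p)) by exact: measurableT_comp.
have mkv : measurable_fun setT (fun p => k (v p)) by exact: measurableT_comp.
move=> kl; have k0 r : (0 <= k r)%R by case: (kl r 0%R).
rewrite -(Lnorm_image mf mfmu)// -(Lnorm_image mg mgnu)//.
have mkuf := measurable_comp_pair mf mku.
have mkvg := measurable_comp_pair mg mkv.
split; apply: Lnorm2_triangle => //;
  try exact: measurable_image_sub; move=> p; rewrite !(ger0_norm (k0 _)).
  by case: (kl (u (f p.1, f p.2)) (v (g p.1, g p.2))).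
by rewrite distrC; case: (kl (v (g p.1, g p.2)) (u (f p.1, f p.2))).
Qed.

End two_images.

(** * The diagonal coupling *)

Definition diag {T : Type} (x : T) : T * T := (x, x).

Section diagonal.
Local Open Scope ereal_scope.
Context d {T : measurableType d} {R : realType}.
Variable mu : probability T R.

Lemma measurable_diag : measurable_fun setT (@diag T).
Proof. exact: measurable_fun_pair. Qed.

HB.instance Definition _ := isMeasurableFun.Build _ _ _ _ (@diag T) measurable_diag.

Definition diag_coupling : probability (T * T)%type R := distribution mu (@diag T).

Lemma Lnorm2_diag_coupling (u v : T * T -> R) :
    measurable_fun setT u -> measurable_fun setT v ->
  'N[diag_coupling \x diag_coupling]_2%:E[EFin \o
    (fun q => u (q.1.1, q.2.1) - v (q.1.2, q.2.2))%R] =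
  'N[mu \x mu]_2%:E[EFin \o (fun p => u p - v p)%R].
Proof.
move=> m_u m_v.
rewrite -(@Lnorm_image _ _ _ _ _ mu diag_coupling (@diag T) measurable_diag)//.
  by congr Lnorm; apply/funext => -[x y].
exact: measurable_image_sub.
Qed.

Lemma ae_diag_coupling (u : T * T -> R) : measurable_fun setT u ->
  \forall q \ae diag_coupling \x diag_coupling, u (q.1.1, q.2.1) = u (q.1.2, q.2.2).
Proof.
(* With both functions equal to [u], the right-hand norm is that of zero, so the difference on the
   left vanishes almost everywhere. *)
move=> m_u; have := Lnorm2_diag_coupling m_u m_u.
under [X in _ = 'N[_]__[X]]eq_fun do rewrite /= subrr.
rewrite Lnorm0// => /Lnorm_eq0_eq0 h; near=> q.
apply/eqP; rewrite -subr_eq0 -eqe; apply/eqP; move: (I : [set: _] q); near: q.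
apply: h => //; apply/measurable_EFinP; exact: measurable_image_sub.
Unshelve. all: end_near. Qed.

End diagonal.

(** * Deviation of a network from a finite set of values *)

Section networks.
Context {R : realType}.
Implicit Types X Y Z : network R.
Local Notation bpts X := (borel (pts X)).
Local Notation nmu2 X := (nmu X \x nmu X)%E.

Lemma disE X Y (m : probability (bpts X * bpts Y)%type R) :
  dis m = ('N[(m \x m)%E]_2%:E[EFin \o
    (fun q => nomega X (q.1.1, q.2.1) - nomega Y (q.1.2, q.2.2))%R])%E.
Proof.
rewrite /dis unlock /=.
apply: (congr1 (@poweR R ^~ 2^-1%R)).
rewrite fubini_tonelli1 /fubini_F /=.
- by apply: eq_integral => p _; apply: eq_integral => q _; rewrite powR_mulrn.
- by apply: measurable_sqr_norm; exact: measurable_image_sub.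
- by move=> x; rewrite lee_fin powR_ge0.
Qed.

(** The L2 norm of h o omega_X, with h the distance to the entries of [a :: l]. *)
Definition value_dev a l X : \bar R :=
  ('N[nmu2 X]_2%:E[EFin \o (fun p => dist_seq a l (nomega X p))])%E.

Lemma value_dev_weak_iso a l X Y : weak_iso X Y -> value_dev a l X = value_dev a l Y.
Proof.
move=> [W [muW [pX [pY [[mX mY] iX iY N0]]]]].
rewrite /value_dev.
apply: (Lnorm2_ae_eq_image mX mY iX iY) => //; first exact: measurable_dist_seq.
have mw : measurable_fun setT (fun w => (nomega X (pX w.1, pX w.2)
                       - nomega Y (pY w.1, pY w.2))%:E).
  by apply/measurable_EFinP; exact: measurable_image_sub.
apply: filterS (Lnorm_eq0_eq0 mw (ltry 0) N0) => w /(_ I) [] /eqP.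
by rewrite subr_eq0 => /eqP.
Qed.

Lemma value_dev_dis a l X Y (m : probability (bpts X * bpts Y)%type R) :
  couplings m ->
  (value_dev a l X <= dis m + value_dev a l Y)%E /\
  (value_dev a l Y <= dis m + value_dev a l X)%E.
Proof.
move=> [iX iY]; rewrite disE.
apply: Lnorm2_lip_image => //; first exact: measurable_dist_seq.
by move=> r s; rewrite dist_seq_ge0 dist_seq_lip.
Qed.

Lemma weak_iso_refl X : weak_iso X X.
Proof.
exists (pts X), (nmu X), id, id; split => //.
rewrite (_ : (fun _ => _) = cst 0%E) ?Lnorm0//.
by apply/funext => w /=; rewrite subrr.
Qed.

(** The diagonal coupling is a competitor in the infimum, and along it the two copies of [nomega Z]
    cancel. *)
Lemma gw_dist_shift_le Z (f g : L2fun (nmu2 Z)) :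
  (gw_dist (Defs.shift f) (Defs.shift g) <=
    (2^-1)%:E * 'N[nmu2 Z]_2%:E[EFin \o (fun p => f p - g p)%R])%E.
Proof.
rewrite /gw_dist lee_pmul2l// ?lte_fin//.
apply: ereal_inf_lbound.
exists (diag_coupling (nmu Z) : probability (bpts (Defs.shift f) * bpts (Defs.shift g))%type R) => //.
rewrite disE /= (Lnorm2_diag_coupling (nmu Z))//.
by congr Lnorm; apply/funext => p /=; rewrite opprD addrACA subrr add0r.
Qed.

Lemma tangent_equiv_refl (C : nclass R) (a : tangent_rep C) : tangent_equiv a a.
Proof.
exists (diag_coupling (nmu (tr_base a))) => //.
have h1 := ae_diag_coupling (nmu (tr_base a)) (u := nomega (tr_base a)) (measurable_funPT _).
have h2 := ae_diag_coupling (nmu (tr_base a)) (u := tr_fun a) (measurable_funPT _).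
by apply: filterS2 h1 h2.
Qed.

Lemma value_dev_eq0 a l X :
  (forall p, nomega X p \in a :: l) -> value_dev a l X = 0%E.
Proof.
move=> Xl; rewrite /value_dev (_ : EFin \o _ = cst 0%E) ?Lnorm0//.
by apply/funext => p /=; congr EFin; apply/dist_seq_eq0.
Qed.

(** With the invariance of [value_dev], this carries the finite set of values of a network over to
    all weakly isomorphic ones. *)
Lemma value_dev_eq0_ae a l X : value_dev a l X = 0%E ->
  \forall p \ae nmu2 X, nomega X p \in a :: l.
Proof.
have mX : measurable_fun setT (EFin \o (fun p => dist_seq a l (nomega X p))).
  by apply/measurable_EFinP; apply: measurableT_comp => //; exact: measurable_dist_seq.
move=> /(Lnorm_eq0_eq0 mX); rewrite lte_fin ltr0n => /(_ isT).
by apply: filterS => p /(_ I) [] /dist_seq_eq0.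
Qed.

(** Since |s f| stays below [e] almost everywhere, the entry nearest to omega_Z + s f is still
    omega_Z, at distance s |f|. *)
Lemma value_dev_shift a l e Z (f : L2fun (nmu2 Z)) s :
    {in a :: l &, forall b c, b != c -> e + e <= `|b - c|} ->
    (\forall p \ae nmu2 Z, nomega Z p \in a :: l) ->
    (\forall p \ae nmu2 Z, `|f p| <= e) -> 0 <= s <= 1 ->
  value_dev a l (Defs.shift (s *: f)) = (s%:E * 'N[nmu2 Z]_2%:E[EFin \o f])%E.
Proof.
move=> gap Zl fe /andP[s0 s1]; rewrite /value_dev /=.
transitivity ('N[nmu2 Z]_2%:E[EFin \o (s *: f : L2fun (nmu2 Z))])%E.
  have mZ : measurable_fun setT (fun p => nomega Z p + s * f p).
    by apply: measurable_funD => //; exact: measurable_funM.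
  apply: ae_eq_Lnorm2 => //; first exact: (measurableT_comp (measurable_dist_seq a l) mZ).
  apply: filterS2 Zl fe => p Zp fp /=.
  rewrite (dist_seq_near Zp gap) ?normr_id//.
  rewrite normrM (ger0_norm s0) (le_trans _ fp)// ler_piMl//.
by have := LnormZ f s; rewrite (ger0_norm s0).
Qed.

Lemma tangent_equiv_bound (C : nclass R) (a b : tangent_rep C) e :
    tangent_equiv a b -> (forall p, `|tr_fun b p| <= e) ->
  \forall p \ae nmu2 (tr_base a), `|tr_fun a p| <= e.
Proof.
move=> [m [ia ib] mab] be.
(* This truncation vanishes exactly when [|r| <= e], so the bound becomes a zero L2 norm, which the
   coupling transports. *)
have m_k : measurable_fun setT (fun r : R => Num.max (`|r| - e) 0).
  by apply: measurable_maxr => //; apply: measurable_funB.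
have h : (\forall p \ae (m \x m)%E, tr_fun a (p.1.1, p.2.1) = tr_fun b (p.1.2, p.2.2)).
  by apply: filterS mab => p [].
have := Lnorm2_ae_eq_image _ _ ia ib _ _ m_k h.
rewrite [in RHS](_ : EFin \o _ = cst 0%E); last first.
  by apply/funext => p /=; rewrite max_r// subr_le0.
rewrite Lnorm0// => /(_ _ _ _ _)/Lnorm_eq0_eq0 H.
have {H} : ae_eq (nmu2 (tr_base a)) setT
   (EFin \o (fun p => Num.max (`|tr_fun a p| - e) 0)) (cst 0%E).
  apply: H => //; apply/measurable_EFinP.
  exact: (measurableT_comp m_k (measurable_funPT _)).
apply: filterS => p /(_ I) /= [] mx.
by rewrite -subr_le0 -mx le_max lexx.
Qed.

Lemma finite_network_values X : finite_network X ->
  exists a l, forall p, nomega X p \in a :: l.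
Proof.
(* Adjoining [0] to the values is harmless: only membership in a finite list is claimed. *)
move=> finX; exists 0.
have /finite_seqP[l lE] : finite_set (range (nomega X)).
  apply: finite_image; rewrite -setXTT; exact: finite_setX.
exists l => p; rewrite in_cons orbC.
by have : range (nomega X) (nomega X p) by []; rewrite lE /= => ->.
Qed.

End networks.

(** The deviation is constant on each class, so [value_dev_dis] bounds [dis] below by the same
    number for all representatives and all couplings. *)
Lemma class_dist_ge {R : realType} a l (C D : nclass R) x y :
    (forall Y, in_class Y C -> value_dev a l Y = x%:E) ->
    (forall Y, in_class Y D -> value_dev a l Y = y%:E) ->
  ((2^-1 * `|y - x|)%:E <= class_dist C D)%E.
Proof.
move=> Cx Dy; apply/ereal_infP => _ [Y [Y' [YC YD ->]]].
rewrite /gw_dist EFinM lee_pmul2l// ?lte_fin//.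
apply/ereal_infP => _ [m mYY' <-].
have := value_dev_dis a l mYY'; rewrite (Cx Y)// (Dy Y')//.
rewrite -!leeBlDr// -!EFinB => -[xy yx].
by case: (ger0P (y - x)) => _; rewrite ?opprB.
Qed.

(** * The geodesic s |-> [Z', omega_Z' + s g] *)

Theorem proposition5 (R : realType) (X : network R) (finX : finite_network X) :
  exists2 eps : R, 0 < eps &
    forall (v : tangent_space (class_of X)) (Z : network R)
           (ZX : in_class Z (class_of X)) (f : L2fun (nmu Z \x nmu Z)%E),
      v = tangent_class (TangentRep ZX f) ->
      (forall z z' : pts Z, `|f (z, z')| < eps) ->
      exists (T : R) (gamma : R -> nclass R),
        is_geodesic 0 T gamma (class_of X) (texp v).
Proof.
have [a [l Xl]] := finite_network_values finX.
have [e e0 gap] := seq_gap (a :: l).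
exists e => // v Z ZX f vE fe.
(* [texp] uses the chosen representative of [v], so the argument runs on [Z'] and [g]; the pointwise
   bound on [f] becomes an almost everywhere bound on [g]. *)
pose Z' := tr_base (tangent_repr v).
pose g : L2fun (nmu Z' \x nmu Z')%E := tr_fun (tangent_repr v).
have vZ : tangent_equiv (tangent_repr v) (TangentRep ZX f).
  have <- : sval v = tangent_equiv (tangent_repr v) := svalP (cid (svalP v)).
  by rewrite vE; exact: tangent_equiv_refl.
have XZ' : weak_iso X Z' := tr_in (tangent_repr v).
have g_le : \forall p \ae (nmu Z' \x nmu Z')%E, `|g p| <= e.
  by apply: (tangent_equiv_bound vZ) => -[z z']; exact/ltW/fe.
have Z'l : \forall p \ae (nmu Z' \x nmu Z')%E, nomega Z' p \in a :: l.
  by apply: value_dev_eq0_ae; rewrite -(value_dev_weak_iso a l XZ') value_dev_eq0.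
pose c := fine ('N[(nmu Z' \x nmu Z')%E]_2%:E[EFin \o g])%E.
have cE : c%:E = ('N[(nmu Z' \x nmu Z')%E]_2%:E[EFin \o g])%E.
  exact: finite_norm_fine.
have c0 : 0 <= c by rewrite fine_ge0// Lnorm_ge0.
(* Setting gamma 0 apart avoids proving that weak isomorphism is transitive,
   which would require gluing couplings. *)
pose gamma (s : R) := if s == 0 then class_of X else class_of (Defs.shift (s *: g)).
have gamma_dev s Y : 0 <= s <= 1 -> in_class Y (gamma s) ->
    value_dev a l Y = (s * c)%:E.
  rewrite /gamma; have [-> _|_ s01] := eqVneq s 0 => /(value_dev_weak_iso a l) <-.
    by rewrite mul0r value_dev_eq0.
  by rewrite (value_dev_shift gap)// -cE.
(* At [s = 0] the shifted network is [Z'] itself, a member of the class of [X]; so the diagonal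
   bound below covers the initial point too. *)
have gamma_rep s : in_class (Defs.shift (s *: g)) (gamma s).
  rewrite /gamma; have [->|_] := eqVneq s 0; last exact: weak_iso_refl.
  have -> // : Defs.shift (0 *: g) = Z'.
  by rewrite /Defs.shift scale0r addr0; case: (Z').
have gamma_dist s t : 0 <= s <= 1 -> 0 <= t <= 1 ->
    class_dist (gamma s) (gamma t) = (2^-1 * (`|t - s| * c))%:E.
  move=> s01 t01; apply/le_anti/andP; split; last first.
    have := class_dist_ge (fun Y => gamma_dev s Y s01) (fun Y => gamma_dev t Y t01).
    by rewrite -mulrBl normrM (ger0_norm c0).
  apply: le_trans (ereal_inf_lbound _) _.
    by exists (Defs.shift (s *: g)), (Defs.shift (t *: g)).
  apply: le_trans (gw_dist_shift_le _ _) _; rewrite EFinM lee_pmul2l// ?lte_fin//.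
  rewrite EFinM cE distrC -(LnormZ g).
  by rewrite le_eqVlt; apply/orP; left; apply/eqP; congr Lnorm; apply/funext => p /=;
    rewrite scalerBl.
exists 1, gamma; split.
- exact: ltr01.
(* Dividing by [c + 1] rather than [c] allows [c = 0]. *)
- move=> s s01 d d0; exists (d / (c + 1)) => [|t t01 ts].
    by rewrite divr_gt0// ltr_wpDl.
  rewrite gamma_dist// lte_fin.
  move: ts; rewrite ltr_pdivlMr ?ltr_wpDl// => ts.
  have : 0 <= `|t - s| * c by rewrite mulr_ge0.
  by have := normr_ge0 (t - s); lra.
- by rewrite /gamma eqxx.
- by rewrite /gamma oner_eq0 scale1r.
- move=> s t s01 t01.
  rewrite gamma_dist//.
  (* The total length is [gamma_dist] at the parameters 0 and 1. *)
  have -> : class_dist (class_of X) (texp v) = (2^-1 * c)%:E.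
    have := gamma_dist 0 1; rewrite /gamma eqxx oner_eq0 scale1r subr0 normr1 mul1r.
    by apply; rewrite ?lexx ?ler01.
  by rewrite subr0 divr1 -EFinM mulrCA.
Qed.
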